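(* Let $\hbar>0$, $n\ge1$, $\mu\in\mathbb{R}$, $\delta\ge0$ with $\mu<-(n+2)\delta$, and let $\sigma:\hbar\mathbb{Z}^n\times\mathbb{T}^n\to\mathbb{C}$ satisfy $|D_\theta^{(\beta)}\sigma(k,\theta)|\le C_\beta(1+|k|)^{\mu+\delta|\beta|}$ for all $k\in\hbar\mathbb{Z}^n$, $\theta\in\mathbb{T}^n$ and all multi-indices $|\beta|\le\lfloor\frac n2\rfloor+1$. Suppose $T_\sigma:\ell^2(\hbar\mathbb{Z}^n)\to\ell^2(\hbar\mathbb{Z}^n)$ has an orthonormal basis of eigenvectors $\{\phi_k\}_{k\in\hbar\mathbb{Z}^n}$ with eigenvalues $\lambda_k$, $T_\sigma\phi_k=\lambda_k\phi_k$, write $\phi_k=e_k+\Delta e_k$, where $\{e_k\}$ is the standard basis, and assume $\|\Delta e_k\|\le1$ for all $k$. Then $$\lambda_k=\int_{\mathbb{T}^n}\sigma(k,\theta)\,d\theta+O\big(|k|^{\mu+(n+2)\delta}\big)\qquad (|k|\to\infty).$$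
   Context: $\hbar\mathbb{Z}^n=\{\hbar z:z\in\mathbb{Z}^n\}$, $\mathbb{T}^n=\mathbb{R}^n/\mathbb{Z}^n$ (identified with $[0,1)^n$). $D_\theta^{(\beta)}$ is the partial derivative of multi-order $\beta$ in $\theta$ (assumed to exist and be continuous in $\theta$ for the $\beta$ concerned); the constants $C_\beta$ do not depend on $k,\theta$. The pseudo-differential operator is $(T_\sigma a)(k)=\int_{\mathbb{T}^n}e^{2\pi\frac i\hbar k\cdot\theta}\sigma(k,\theta)\hat a(\theta)\,d\theta$ with $\hat a(\theta)=\sum_{k\in\hbar\mathbb{Z}^n}a(k)e^{-2\pi\frac i\hbar k\cdot\theta}$; its matrix in the standard basis ($e_k(x)=1$ if $x=k$, $0$ otherwise) is $a_{k,m}=\int_{\mathbb{T}^n}\sigma(k,\theta)e^{2\pi\frac i\hbar(k-m)\cdot\theta}d\theta$. $\|\cdot\|$ is the $\ell^2(\hbar\mathbb{Z}^n)$ norm. *)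

(* Defs.v *)
From HB Require Import structures.
From mathcomp Require Import all_boot all_order all_algebra finmap.
From mathcomp Require Import complex.
From mathcomp Require Import all_classical all_reals all_analysis.
From mathcomp Require summability.

Set Implicit Arguments.
Unset Strict Implicit.
Unset Printing Implicit Defensive.

Import Order.TTheory GRing.Theory Num.Theory.
Import numFieldNormedType.Exports.

Local Open Scope classical_set_scope.
Local Open Scope ring_scope.

(* The lattice hbar Z^n is parametrized by Z^n: a function a on hbar Z^n is
   represented by z |-> a (hbar z), with z : 'rV[int]_n.  The torus is R^n/Z^n:
   functions on it are functions on 'rV[R]_n that are Z^n-periodic, or, for
   functions given only almost everywhere, their values on [0, 1)^n. *)

Local Notation normc := ComplexField.Normc.normc.

Section Lattice.
Context {R : realType} {n : nat}.
Implicit Types (hbar : R) (z : 'rV[int]_n) (x y : 'rV[R]_n).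

Definition latpt hbar z : 'rV[R]_n := hbar *: map_mx intr z.

Definition dotp x y : R := \sum_j x 0 j * y 0 j.

(* Euclidean; the norm `|x| of the library on 'rV[R]_n is the sup norm. *)
Definition enorm x : R := Num.sqrt (dotp x x).

(* e^{2 pi (i / hbar) k . theta} *)
Definition character hbar (k theta : 'rV[R]_n) : R[i] :=
  let t := 2 * pi / hbar * dotp k theta in Complex (cos t) (sin t).

End Lattice.

Section TorusMeasure.
Context {R : realType}.

Local Notation mR := (measurableTypeR R).

Definition tcons n (p : mR * n.-tuple mR) : n.+1.-tuple mR :=
  [tuple of p.1 :: p.2].

Lemma measurable_tcons n : measurable_fun setT (@tcons n).
Proof. by apply: measurable_cons; [exact: measurable_fst|exact: measurable_snd]. Qed.

HB.instance Definition _ n :=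
  isMeasurableFun.Build _ _ _ _ (@tcons n) (@measurable_tcons n).

(* Lebesgue measure on [0, 1]^n, as the n-fold product of the uniform
   probability on [0, 1]. *)
Fixpoint torus_measure n : probability (n.-tuple mR) R :=
  match n with
  | 0 => \d_([tuple] : 0.-tuple mR)
  | n'.+1 => distribution
      (uniform_prob (@ltr01 R) \x torus_measure n')%E (@tcons n')
  end.

Definition torus_pt n (t : n.-tuple (measurableTypeR R)) : 'rV[R]_n := \row_j tnth t j.

Definition torus_int n (g : 'rV[R]_n -> R[i]) : R[i] :=
  Complex (\int[torus_measure n]_t complex.Re (g (torus_pt t)))
          (\int[torus_measure n]_t complex.Im (g (torus_pt t))).

End TorusMeasure.

Section Derivatives.
Context {R : realType} {n : nat}.
Implicit Types (g : 'rV[R]_n -> R[i]) (j : 'I_n).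

Definition torus_periodic g :=
  forall (x : 'rV[R]_n) (z : 'rV[int]_n), g (x + map_mx intr z) = g x.

Definition ccontinuous g :=
  continuous (fun x => complex.Re (g x)) /\
  continuous (fun x => complex.Im (g x)).

Definition pderivable j g (x : 'rV[R]_n) :=
  derivable (fun y => complex.Re (g y)) x (delta_mx 0 j) /\
  derivable (fun y => complex.Im (g y)) x (delta_mx 0 j).

Definition pderiv j g : 'rV[R]_n -> R[i] := fun x =>
  Complex ('D_(delta_mx 0 j) (fun y => complex.Re (g y)) x)
          ('D_(delta_mx 0 j) (fun y => complex.Im (g y)) x).

Fixpoint Cclass (N : nat) g : Prop :=
  ccontinuous g /\
  match N with
  | 0 => True
  | N'.+1 => forall j, (forall x, pderivable j g x) /\ Cclass N' (pderiv j g)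
  end.

Definition mi_order (beta : {ffun 'I_n -> nat}) : nat := (\sum_j beta j)%N.

(* The order of differentiation is irrelevant for functions in
   Cclass (mi_order beta). *)
Definition mderiv (beta : {ffun 'I_n -> nat}) g : 'rV[R]_n -> R[i] :=
  foldr (fun j h => iter (beta j) (pderiv j) h) g (enum 'I_n).

End Derivatives.

Section L2.
Context {R : realType} {n : nat}.
Implicit Types (a b : 'rV[int]_n -> R[i]).

Definition l2 a := summable setT (fun z => (normc (a z) ^+ 2)%:E).

Definition l2norm a : R :=
  Num.sqrt (fine (\esum_(z in setT) (normc (a z) ^+ 2)%:E)).

Definition l2inner a b : R[i] :=
  let p z := a z * (b z)^*%C in
  Complex (summability.sum (fun z => complex.Re (p z)))
          (summability.sum (fun z => complex.Im (p z))).

Definition std_basis (k : 'rV[int]_n) : 'rV[int]_n -> R[i] :=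
  fun z => (z == k)%:R.

Definition orthonormal_basis (phi : 'rV[int]_n -> 'rV[int]_n -> R[i]) :=
  [/\ forall k, l2 (phi k),
      forall k l, l2inner (phi k) (phi l) = (k == l)%:R
    & forall a, l2 a -> forall eps : R, 0 < eps ->
        exists (F : {fset 'rV[int]_n}) (c : 'rV[int]_n -> R[i]),
          l2norm (fun z => a z - \sum_(k <- F) c k * phi k z) < eps].

End L2.

Section PseudoDifferential.
Context {R : realType} {n : nat}.
Implicit Types (hbar : R) (a : 'rV[int]_n -> R[i]) (f : 'rV[R]_n -> R[i])
  (sigma : 'rV[int]_n -> 'rV[R]_n -> R[i]).

Definition fourier_psum hbar a (F : {fset 'rV[int]_n})
    (theta : 'rV[R]_n) : R[i] :=
  \sum_(z <- F) a z * character hbar (- latpt hbar z) theta.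

(* For a in l^2 the series defining the Fourier transform converges
   (unconditionally) only in the L^2 sense; f is determined up to a null set. *)
Definition is_fourier hbar a f :=
  [/\ measurable_fun setT (fun t : n.-tuple (measurableTypeR R) => complex.Re (f (torus_pt t))),
      measurable_fun setT (fun t : n.-tuple (measurableTypeR R) => complex.Im (f (torus_pt t)))
    & (fun F : {fset 'rV[int]_n} => \int[torus_measure n]_t
         (normc (f (torus_pt t) - fourier_psum hbar a F (torus_pt t)) ^+ 2)%:E)%E
      @ summability.totally --> 0%E].

(* The default value is irrelevant for a in l^2: by Riesz-Fischer some f with
   is_fourier hbar a f exists, and Tsigma does not depend on its choice. *)
Definition fourier hbar a : 'rV[R]_n -> R[i] :=
  xget (fun=> 0) [set f | is_fourier hbar a f].

Definition Tsigma hbar sigma a : 'rV[int]_n -> R[i] := fun k =>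
  torus_int (fun theta =>
    character hbar (latpt hbar k) theta * sigma k theta * fourier hbar a theta).

Definition symbol_estimate hbar (mu delta : R) (N : nat) sigma :=
  exists C : {ffun 'I_n -> nat} -> R,
    forall beta : {ffun 'I_n -> nat}, (mi_order beta <= N)%N ->
    forall k theta,
      normc (mderiv beta (sigma k) theta) <=
        C beta * (1 + enorm (latpt hbar k)) `^ (mu + delta * (mi_order beta)%:R).

End PseudoDifferential.

(* Main.v *)
Require Import Defs.
From mathcomp Require Import all_boot all_order all_algebra finmap.
From mathcomp Require Import complex.
From mathcomp Require Import all_classical all_reals all_analysis.
From mathcomp Require Import measurable_realfun.
From mathcomp Require Import ring lra.
From mathcomp Require summability.
Import Order.TTheory GRing.Theory Num.Theory.
Import numFieldNormedType.Exports.
Local Open Scope classical_set_scope.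
Local Open Scope ring_scope.

(** Both [lambda k] and the mean of [sigma k] are already of size
    [(1 + |k|) ^ mu], so the estimate follows from the triangle inequality and
    no cancellation between them is used.

    Let [M] bound [sigma k] uniformly on the torus; the case [beta = 0] of the
    symbol estimate gives such an [M] of order [(1 + |k|) ^ mu].  The mean is
    then bounded by a multiple of [M].  For the eigenvalue, evaluate the
    eigenvector equation on the diagonal:
    [lambda k * phi k k = (T_sigma (phi k)) k].

    - The right-hand side is the integral of a unimodular character times
      [sigma k] times the Fourier transform of [phi k], so it is at most [M]
      times the L^1 norm of that transform, up to a constant
      ([normc_Tsigma_le]).  The L^1 norm is bounded because [phi k] is a unit
      vector: Parseval for trigonometric polynomials ([parseval_trig]) bounds
      the partial sums in L^2, these converge to the transform in L^2, and the
      torus has mass one ([fourier_L1_majorant]).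
    - The factor [phi k k] stays away from zero.  Since [phi k] and [e_k] are
      unit vectors, [|phi k - e_k|^2 = 2 - 2 Re (phi k k)], and the left-hand
      side is at most one, whence [Re (phi k k) >= 1/2]
      ([diagonal_coeff_ge]).

    So [|lambda k|] is at most a multiple of [M], and
    [(1 + |k|) ^ mu <= |k| ^ (mu + (n + 2) delta)] for [|k| >= 1], because the
    exponent on the right is negative and not below [mu] ([powR_shift_le]). *)

Local Notation normc := ComplexField.Normc.normc.

(** * Modulus of a complex number *)

Lemma normc_ge0 {R : rcfType} (x : R[i]) : 0 <= normc x.
Proof. by case: x => a b /=; rewrite sqrtr_ge0. Qed.

Lemma normc_sqr {R : rcfType} (x : R[i]) :
  normc x ^+ 2 = complex.Re (x * (x^*)%C).
Proof. by case: x => a b; rewrite /= sqr_sqrtr ?addr_ge0 ?sqr_ge0//; ring. Qed.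

Lemma normr_Re_le {R : rcfType} (x : R[i]) : `|complex.Re x| <= normc x.
Proof. by case: x => a b; rewrite /= -sqrtr_sqr ler_wsqrtr// lerDl sqr_ge0. Qed.

Lemma normr_Im_le {R : rcfType} (x : R[i]) : `|complex.Im x| <= normc x.
Proof. by case: x => a b; rewrite /= -sqrtr_sqr ler_wsqrtr// lerDr sqr_ge0. Qed.

Lemma normc_le_ReIm {R : rcfType} (x : R[i]) :
  normc x <= `|complex.Re x| + `|complex.Im x|.
Proof.
case: x => a b /=; rewrite -[leRHS]ger0_norm ?addr_ge0// -[leRHS]sqrtr_sqr.
rewrite ler_wsqrtr// sqrrD !real_normK ?num_real// addrAC lerDl.
by rewrite mulrn_wge0 ?mulr_ge0.
Qed.

(** * Sums of nonnegative families *)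

Lemma fsum_le_esum {R : realType} {I : choiceType} (x : I -> R)
    (F : {fset I}) :
  ((\sum_(i <- F) x i)%:E <= \esum_(i in [set: I]) (x i)%:E)%E.
Proof.
apply: esum_ge; exists [set` F]; first by split=> //; exact: finite_fset.
by rewrite fsbig_finite; [rewrite set_fsetK sumEFin|exact: finite_fset].
Qed.

(** Links the two notions of sum in use: inner products are limits of partial
    sums along finite sets, norms are suprema of them. *)
Lemma sum_esum {R : realType} {I : choiceType} (x : I -> R) :
  (forall i, 0 <= x i) -> (\esum_(i in [set: I]) (x i)%:E < +oo)%E ->
  (summability.sum x)%:E = (\esum_(i in [set: I]) (x i)%:E)%E.
Proof.
move=> x0 xoo; set S := esum _ _ in xoo *.
have S0 : (0 <= S)%E by apply: esum_ge0 => i _; rewrite lee_fin.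
have fS : S \is a fin_num by rewrite ge0_fin_numE.
rewrite -(fineK fS); congr (_%:E).
have TF := @summability.totally_filter I.
apply: cvg_lim => //; apply/cvgrPdist_lt => e e0.
have : (S - e%:E < S)%E by rewrite lteBlDr// lteDl ?lte_fin.
move=> /ereal_sup_gt[_ [A [finA _] <-] SA].
exists (fset_set A) => // B /= AB.
rewrite /summability.partial_sum -(big_seq_fsetE _ _ predT).
rewrite ger0_norm; last by rewrite subr_ge0 -lee_fin fineK// fsum_le_esum.
rewrite ltrBlDr -ltrBlDl -lte_fin EFinB fineK//; apply: lt_le_trans SA _.
rewrite fsbig_finite// -sumEFin; apply: lee_sum_nneg_subfset => [i|i _ _].
  exact: (fsubsetP AB).
by rewrite lee_fin.
Qed.

(** * Orthonormal bases close to the standard one *)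

Lemma orthonormal_esum {R : realType} {n : nat}
    {phi : 'rV[int]_n -> 'rV[int]_n -> R[i]} :
  orthonormal_basis phi -> forall k,
  (\esum_(z in [set: 'rV[int]_n]) (normc (phi k z) ^+ 2)%:E = 1%:E)%E.
Proof.
move=> phi_basis k; have [/(_ k) l2k /(_ k k) ok _] := phi_basis.
rewrite -sum_esum => [|z|]; last 2 first.
- exact: sqr_ge0.
- by apply: le_lt_trans l2k; apply: le_esum => z _; exact: lee_abs.
congr (_%:E); move: ok => /(congr1 (@complex.Re R)); rewrite eqxx /= => <-.
by congr summability.sum; apply/funext => z; rewrite normc_sqr.
Qed.

Lemma orthonormal_fsum_le1 {R : realType} {n : nat}
    {phi : 'rV[int]_n -> 'rV[int]_n -> R[i]} :
  orthonormal_basis phi -> forall k (F : {fset 'rV[int]_n}),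
  \sum_(z <- F) normc (phi k z) ^+ 2 <= 1.
Proof.
by move=> phi_basis k F; rewrite -lee_fin -(orthonormal_esum phi_basis k)
  fsum_le_esum.
Qed.

(** [phi k] and its deviation from [e_k] agree off the diagonal, so comparing
    [|phi k|^2 = 1] with [|Delta|^2 <= 1] leaves
    [|phi k k - 1|^2 <= |phi k k|^2]. *)
Lemma diagonal_coeff_ge {R : realType} {n : nat}
    {phi : 'rV[int]_n -> 'rV[int]_n -> R[i]} (Delta : 'rV[int]_n -> R[i]) k :
  orthonormal_basis phi ->
  (forall m, phi k m = std_basis k m + Delta m) -> l2norm Delta <= 1 ->
  2^-1 <= normc (phi k k).
Proof.
move=> phi_basis split_k.
have sq0 (a : 'rV[int]_n -> R[i]) z : (0 <= (normc (a z) ^+ 2)%:E)%E.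
  by rewrite lee_fin sqr_ge0.
have splitk (a : 'rV[int]_n -> R[i]) :
    (\esum_(z in [set: 'rV[int]_n]) (normc (a z) ^+ 2)%:E =
    (normc (a k) ^+ 2)%:E + \esum_(z in ~` [set k]) (normc (a z) ^+ 2)%:E)%E.
  by rewrite (esumID [set k])// !setTI esum_set1.
have off : (\esum_(z in ~` [set k]) (normc (Delta z) ^+ 2)%:E =
    \esum_(z in ~` [set k]) (normc (phi k z) ^+ 2)%:E)%E.
  apply: eq_esum => z zk; rewrite split_k /std_basis.
  by rewrite (negbTE (introN eqP zk)) add0r.
have := orthonormal_esum phi_basis k; rewrite splitk.
rewrite /l2norm splitk off split_k /std_basis eqxx.
have : (0 <= \esum_(z in ~` [set k]) (normc (phi k z) ^+ 2)%:E)%E.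
  exact: esum_ge0.
case: esum => // r _; case: (Delta k) => x y [E].
have {}E : ((1 + x) ^+ 2 + y ^+ 2) + r = 1.
  by rewrite sqr_sqrtr ?addr_ge0 ?sqr_ge0// add0r in E.
move=> H.
have {}H : x ^+ 2 + y ^+ 2 + r <= 1.
  rewrite /= sqr_sqrtr ?addr_ge0 ?sqr_ge0// in H.
  (* a negative radicand would make the square root vanish *)
  have [/ltW r0|r0] := ltP (x ^+ 2 + y ^+ 2 + r) 0; first exact: le_trans r0 _.
  by rewrite -ler_sqrt// sqrtr1.
apply: le_trans (normr_Re_le _); rewrite /=.
by apply: le_trans (ler_norm _); nra.
Qed.

(** * Integrals of functions not known to be measurable *)

(** The integral of a nonnegative function is a supremum over the simple
    functions below it, hence monotone without measurability.  This spares
    proving that continuous functions on row vectors are measurable for the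
    product sigma-algebra on tuples. *)
Lemma ge0_le_integral_majorant d (T : measurableType d) (R : realType)
    (mu : {measure set T -> \bar R}) (f g : T -> \bar R) :
  (forall x, 0 <= f x)%E -> (forall x, f x <= g x)%E ->
  (\int[mu]_x f x <= \int[mu]_x g x)%E.
Proof.
move=> f0 fg; rewrite !ge0_integralTE//; last first.
  by move=> x; exact: le_trans (fg x).
by apply: le_ereal_sup => _ [h hf <-]; exists h => // x; exact: le_trans (fg x).
Qed.

Lemma normr_Rintegral_le_majorant d (T : measurableType d) (R : realType)
    (mu : {measure set T -> \bar R}) (f : T -> R) (h : T -> \bar R) (M : R) :
  (forall x, `|f x|%:E <= h x)%E -> (\int[mu]_x h x <= M%:E)%E ->
  `|\int[mu]_x f x| <= M.
Proof.
move=> fh hM; rewrite /Rintegral integralE.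
have bnd (g : T -> \bar R) :
    (forall x, 0 <= g x)%E -> (forall x, g x <= `|f x|%:E)%E ->
    exists2 r : R, (\int[mu]_x g x = r%:E)%E & 0 <= r <= M.
  move=> g0 gf.
  have I0 : (0 <= \int[mu]_x g x)%E by exact: integral_ge0.
  have IM : (\int[mu]_x g x <= M%:E)%E.
    apply: le_trans hM; apply: ge0_le_integral_majorant => // x.
    exact: le_trans (fh x).
  exists (fine (\int[mu]_x g x)).
    by rewrite fineK// ge0_fin_numE// (le_lt_trans IM) ?ltry.
  by rewrite -!lee_fin fineK ?I0 ?IM// ge0_fin_numE// (le_lt_trans IM) ?ltry.
have [||p -> p0] := bnd ((fun x => (f x)%:E)^\+)%E => [//|x|].
  by rewrite funeposE -EFin_max lee_fin ge_max ler_norm normr_ge0.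
have [||q -> q0] := bnd ((fun x => (f x)%:E)^\-)%E => [//|x|].
  by rewrite funenegE -EFinN -EFin_max lee_fin ge_max -normrN ler_norm
    normr_ge0.
by rewrite /= ler_norml; lra.
Qed.

Lemma normc_torus_int_le {R : realType} {n : nat} {g : 'rV[R]_n -> R[i]}
    (h : n.-tuple (measurableTypeR R) -> \bar R) (M : R) :
  (forall t, (normc (g (torus_pt t)))%:E <= h t)%E ->
  (\int[torus_measure n]_t h t <= M%:E)%E ->
  normc (torus_int g) <= 2 * M.
Proof.
move=> gh hM; apply: le_trans (normc_le_ReIm _) _; rewrite mulr_natl mulr2n.
apply: lerD; apply: normr_Rintegral_le_majorant hM => t; apply: le_trans (gh t);
  rewrite lee_fin; [exact: normr_Re_le|exact: normr_Im_le].
Qed.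

(** * Orthogonality of the characters of the torus *)

Lemma sinD_int {R : realType} (a : R) (m : int) :
  sin (a + 2 * pi * m%:~R) = sin a.
Proof.
have -> : 2 * pi * m%:~R = (pi *+ 2) *~ m :> R by rewrite mulrzr mulr_natl.
case: m => m; first exact: (periodicn (@sinD2pi R)).
rewrite NegzE mulrNz -[LHS](periodicn (@sinD2pi R) m.+1).
by congr sin; exact: subrK.
Qed.

(** The constant [1] makes the integrand nonnegative, which is what the
    computation of integrals against the uniform probability and Tonelli's
    theorem ask for. *)
Lemma integral_cos_affine {R : realType} (alpha : R) (m : int) : m != 0 ->
  (\int[uniform_prob (@ltr01 R)]_x
     (1 + cos (alpha + 2 * pi * (m%:~R * x)))%:E = 1%:E)%E.
Proof.
move=> m0.
have w0 : 2 * pi * m%:~R != 0 :> R.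
  by rewrite !mulf_neq0// ?intr_eq0// gt_eqF// pi_gt0.
set w : R := 2 * pi * m%:~R in w0.
have E x : 2 * pi * (m%:~R * x) = w * x by rewrite /w; ring.
under eq_integral do rewrite E.
pose F x := x + w^-1 * sin (alpha + w * x).
have dF (x : R) : is_derive x 1 F (1 + cos (alpha + w * x)).
  by rewrite /F; apply: is_derive_eq; rewrite /GRing.scale /=; field; exact: w0.
have df (x : R) : is_derive x 1 (fun x : R => 1 + cos (alpha + w * x))
    (- w * sin (alpha + w * x)).
  by apply: is_derive_eq; rewrite /GRing.scale /=; ring.
have cf : continuous (fun x : R => 1 + cos (alpha + w * x)).
  move=> x; apply: differentiable_continuous; apply/derivable1_diffP.
  by apply: ex_derive; exact: df.
have cF : continuous F.
  move=> x; apply: differentiable_continuous; apply/derivable1_diffP.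
  by apply: ex_derive; exact: dF.
rewrite integral_uniform; last 2 first.
- by apply/measurable_EFinP; apply: continuous_measurable_fun.
- by move=> x; rewrite lee_fin -lerBlDl sub0r cos_geN1.
rewrite subr0 invr1 mul1e (@continuous_FTC2 _ _ F)//.
- by rewrite -EFinB; congr (_%:E); rewrite /F mulr1 mulr0 sinD_int addr0; ring.
- exact: continuous_subspaceT.
- split; first by move=> x _; apply: ex_derive; exact: dF.
  + by apply: cvg_at_right_filter; exact: cF.
  + by apply: cvg_at_left_filter; exact: cF.
- by move=> x _; rewrite derive1E; apply: derive_val.
Qed.

(** Frequencies are functions on ['I_n] rather than row vectors, so that the
    first coordinate can be split off in an induction on the dimension. *)
Definition phase {R : realType} {n : nat} (u : 'I_n -> int)
    (t : n.-tuple (measurableTypeR R)) : R :=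
  \sum_j (u j)%:~R * tnth t j.

Lemma phaseB {R : realType} {n : nat} (u v : 'I_n -> int)
    (t : n.-tuple (measurableTypeR R)) :
  phase (fun j => u j - v j) t = phase u t - phase v t.
Proof.
by rewrite /phase -sumrB; apply: eq_bigr => j _; rewrite intrB mulrBl.
Qed.

Lemma phase_tcons {R : realType} {n : nat} (u : 'I_n.+1 -> int)
    (x : measurableTypeR R) (t : n.-tuple (measurableTypeR R)) :
  phase u (tcons (x, t)) =
    (u ord0)%:~R * x + phase (fun j => u (lift ord0 j)) t.
Proof.
rewrite /phase big_ord_recl; congr (_ * _ + _).
by apply: eq_bigr => j _; congr (_ * _); rewrite !(tnth_nth 0).
Qed.

Lemma measurable_phase {R : realType} {n : nat} (u : 'I_n -> int) :
  measurable_fun setT (@phase R n u).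
Proof.
apply: measurable_sum => j; apply: measurable_funM; first exact: measurable_cst.
exact: measurable_tnth.
Qed.

Lemma measurable_cos_phase {R : realType} {n : nat} (u : 'I_n -> int)
    (alpha : R) :
  measurable_fun setT (fun t : n.-tuple (measurableTypeR R) =>
    cos (alpha + 2 * pi * phase u t)).
Proof.
apply: (measurableT_comp (f := @cos R)).
  by apply: continuous_measurable_fun; exact: continuous_cos.
apply: measurable_funD => //; apply: measurable_funM => //.
exact: measurable_phase.
Qed.

(** The offset [alpha] lets the induction on the dimension absorb the first
    coordinate, and turns cosines into sines. *)
Lemma integral_cos_phase {R : realType} {n : nat} (u : 'I_n -> int)
    (alpha : R) :
  (exists j, u j != 0) ->
  (\int[torus_measure n]_t (1 + cos (alpha + 2 * pi * phase u t))%:E = 1%:E)%E.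
Proof.
elim: n u alpha => [|n IH] u alpha [j uj0]; first by case: j uj0.
have mf : measurable_fun setT (fun t : n.+1.-tuple (measurableTypeR R) =>
    (1 + cos (alpha + 2 * pi * phase u t))%:E).
  apply/measurable_EFinP; apply: measurable_funD => //.
  exact: measurable_cos_phase.
have ge0 (x : R) : (0 <= (1 + cos x)%:E)%E.
  by rewrite lee_fin -lerBlDl sub0r cos_geN1.
rewrite /= ge0_integral_distribution//.
set v := fun j => u (lift ord0 j).
have mg : measurable_fun setT
    (fun p : measurableTypeR R * n.-tuple (measurableTypeR R) =>
    (1 + cos (alpha + 2 * pi * phase u (tcons p)))%:E).
  exact: (measurableT_comp mf (@measurable_tcons R n)).
(* If a later frequency is nonzero, integrate the later coordinates first;
   otherwise only the first frequency is present. *)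
have [[i vi]|v0] := pselect (exists i, v i != 0).
  rewrite fubini_tonelli1//=.
  rewrite [LHS](_ : _ = \int[uniform_prob (@ltr01 R)]_x (cst 1%:E x))%E.
    by rewrite integral_cst//=
      [X in (_ * X)%E](@probability_setT _ _ _ (uniform_prob (@ltr01 R))) mule1.
  apply: eq_integral => x _; rewrite /fubini_F /=.
  rewrite -[RHS](IH v (alpha + 2 * pi * ((u ord0)%:~R * x))); last by exists i.
  by apply: eq_integral => t _; rewrite phase_tcons mulrDr addrA.
have {}v0 i : v i = 0.
  by apply/eqP/negP => /negP vi; apply: v0; exists i.
have u0 : u ord0 != 0.
  by case: (unliftP ord0 j) uj0 => [i ->|-> //]; rewrite -/(v i) v0 eqxx.
rewrite fubini_tonelli2//=.
rewrite [LHS](_ : _ = \int[torus_measure n]_x (cst 1%:E x))%E.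
  by rewrite integral_cst//=
    [X in (_ * X)%E](@probability_setT _ _ _ (torus_measure n)) mule1.
apply: eq_integral => t _; rewrite /fubini_G /=.
rewrite -[RHS](integral_cos_affine alpha _ u0).
apply: eq_integral => x _; rewrite phase_tcons.
by rewrite [phase _ _]big1 ?addr0// => i _; rewrite -/(v i) v0 mul0r.
Qed.

Lemma integrable_cos_phase {R : realType} {n : nat} (u : 'I_n -> int)
    (alpha : R) :
  (torus_measure n).-integrable setT
    (EFin \o (fun t => cos (alpha + 2 * pi * phase u t))).
Proof.
apply: measurable_bounded_integrable => //.
- by rewrite [X in (X < _)%E](@probability_setT _ _ _ (torus_measure n)) ltry.
- exact: measurable_cos_phase.
- exists 1; split => // x x1 t _ /=; apply: le_trans (ltW x1).
  by rewrite ler_norml cos_geN1 cos_le1.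
Qed.

Lemma Rintegral_cos_phase {R : realType} {n : nat} (u : 'I_n -> int)
    (alpha : R) :
  \int[torus_measure n]_t cos (alpha + 2 * pi * phase u t) =
    if `[< exists j, u j != 0 >] then 0 else cos alpha.
Proof.
have PT := @probability_setT _ _ R (torus_measure n).
case: asboolP => [u0|u0]; last first.
  rewrite [LHS](_ : _ = \int[torus_measure n]_t cos alpha).
    by rewrite Rintegral_cst//= PT mulr1.
  apply: eq_Rintegral => t _; rewrite [phase _ _]big1 ?mulr0 ?addr0// => j _.
  by have [->|uj] := eqVneq (u j) 0; [rewrite mul0r|case: u0; exists j].
have := congr1 fine (integral_cos_phase _ alpha u0).
rewrite -[LHS]/(\int[torus_measure n]_t
  (1 + cos (alpha + 2 * pi * phase u t))).
rewrite RintegralD//; last 2 first.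
- by apply: finite_measure_integrable_cst.
- exact: integrable_cos_phase.
by rewrite Rintegral_cst//= PT mulr1 => /(canRL (addKr 1)) ->; rewrite addNr.
Qed.

(** * Fourier partial sums and Parseval's identity *)

Lemma normc_character {R : realType} {n : nat} (hbar : R) (k x : 'rV[R]_n) :
  normc (character hbar k x) = 1.
Proof. by rewrite /= cos2Dsin2 sqrtr1. Qed.

Lemma character_dual {R : realType} {n : nat} (hbar : R) (z : 'rV[int]_n)
    (t : n.-tuple (measurableTypeR R)) : hbar != 0 ->
  character hbar (- latpt hbar z) (torus_pt t) =
  let s := 2 * pi * phase (z 0) t in Complex (cos s) (- sin s).
Proof.
move=> h0; rewrite /character /=.
suff -> : 2 * pi / hbar * dotp (- latpt hbar z) (torus_pt t) =
    - (2 * pi * phase (z 0) t) by rewrite cosN sinN.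
rewrite /dotp /phase !mulr_sumr -sumrN; apply: eq_bigr => j _.
by rewrite !mxE; field.
Qed.

(** A phase-shifted cosine in place of the sine, so that the results on
    [cos (alpha + _)] cover both. *)
Lemma sin_cos_shift {R : realType} (x : R) : sin x = cos (- (pi / 2) + x).
Proof.
by rewrite [- _ + _]addrC cosB cos_pihalf sin_pihalf mulr0 mulr1 add0r.
Qed.

Lemma measurable_fourier_psum {R : realType} {n : nat} (hbar : R)
    (a : 'rV[int]_n -> R[i]) (F : {fset 'rV[int]_n}) : hbar != 0 ->
  measurable_fun setT (fun t : n.-tuple (measurableTypeR R) =>
     complex.Re (fourier_psum hbar a F (torus_pt t))) /\
  measurable_fun setT (fun t : n.-tuple (measurableTypeR R) =>
     complex.Im (fourier_psum hbar a F (torus_pt t))).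
Proof.
move=> h0.
have mc u (b c : R) : measurable_fun setT
    (fun t : n.-tuple (measurableTypeR R) =>
     b * cos (c + 2 * pi * phase u t)).
  by apply: measurable_funM => //; exact: measurable_cos_phase.
split.
  rewrite [X in measurable_fun _ X](_ : _ = fun t => \sum_(z <- F)
    (complex.Re (a z) * cos (0 + 2 * pi * phase (z 0) t) +
     complex.Im (a z) * cos (- (pi / 2) + 2 * pi * phase (z 0) t))).
    by apply: measurable_sum => z; apply: measurable_funD.
  apply/funext => t; rewrite raddf_sum; apply: eq_bigr => z _.
  rewrite character_dual// -sin_cos_shift add0r.
  by case: (a z) => x y /=; ring.
rewrite [X in measurable_fun _ X](_ : _ = fun t => \sum_(z <- F)
    (complex.Im (a z) * cos (0 + 2 * pi * phase (z 0) t) +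
     - complex.Re (a z) * cos (- (pi / 2) + 2 * pi * phase (z 0) t))).
  by apply: measurable_sum => z; apply: measurable_funD.
apply/funext => t; rewrite raddf_sum; apply: eq_bigr => z _.
rewrite character_dual// -sin_cos_shift add0r.
by case: (a z) => x y /=; ring.
Qed.

(** Expanding the square gives a double sum whose terms off the diagonal have a
    nonzero frequency [z - w] and so integrate to zero. *)
Lemma parseval_trig {R : realType} {n : nat} (hbar : R)
    (a : 'rV[int]_n -> R[i]) (F : {fset 'rV[int]_n}) : hbar != 0 ->
  (\int[torus_measure n]_t
     (normc (fourier_psum hbar a F (torus_pt t)) ^+ 2)%:E =
   (\sum_(z <- F) normc (a z) ^+ 2)%:E)%E.
Proof.
move=> h0.
pose A z w := a z * (a w)^*%C.
pose g z w (t : n.-tuple (measurableTypeR R)) :=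
  complex.Re (A z w) * cos (0 + 2 * pi * phase (fun j => z 0 j - w 0 j) t) +
  complex.Im (A z w) *
    cos (- (pi / 2) + 2 * pi * phase (fun j => z 0 j - w 0 j) t).
have expand t : normc (fourier_psum hbar a F (torus_pt t)) ^+ 2 =
    \sum_(z <- F) \sum_(w <- F) g z w t.
  rewrite normc_sqr /fourier_psum rmorph_sum big_distrlr raddf_sum.
  apply: eq_bigr => z _; rewrite raddf_sum; apply: eq_bigr => w _.
  rewrite /g /A !character_dual// phaseB add0r -sin_cos_shift.
  by rewrite mulrBr cosB sinB; case: (a z) => x y; case: (a w) => x' y' /=; ring.
have intcos z w b (c : R) : (torus_measure n).-integrable setT
    (EFin \o (fun t => b * cos (c + 2 * pi *
      phase (fun j => (z : 'rV[int]_n) 0 j - (w : 'rV[int]_n) 0 j) t))).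
  exact: (integrableZl measurableT b
    (integrable_cos_phase (fun j => z 0 j - w 0 j) c)).
have intg z w : (torus_measure n).-integrable setT (EFin \o g z w).
  exact: (integrableD measurableT (intcos z w _ _) (intcos z w _ _)).
have Ig z w : (\int[torus_measure n]_t (g z w t)%:E =
    (complex.Re (A z w) * (z == w)%:R)%:E)%E.
  rewrite -[LHS](fineK (integrable_fin_num measurableT (intg z w))).
  congr (_%:E); rewrite -[LHS]/(\int[torus_measure n]_t g z w t).
  rewrite RintegralD//; try exact: intcos.
  rewrite !RintegralZl//; try exact: integrable_cos_phase.
  rewrite !Rintegral_cos_phase cos0 cosN cos_pihalf if_same mulr0 addr0.
  congr (_ * _); have [->|zw] := eqVneq z w.
    by rewrite asboolF// => -[j]; rewrite subrr eqxx.
  rewrite asboolT//; apply: contrapT => H; case/eqP: zw; apply/rowP => j.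
  apply/eqP; rewrite -subr_eq0; apply/negP => /negP E.
  by apply: H; exists j.
under eq_integral do rewrite expand -sumEFin.
rewrite (integral_sum measurableT)//; last first.
  move=> z; rewrite [X in integrable _ _ X](_ : _ =
    fun t => \sum_(w <- F) (g z w t)%:E)%E.
    by apply: (integrable_sum measurableT) => w _; exact: intg.
  by apply/funext => t; rewrite sumEFin.
rewrite -sumEFin; apply: eq_big_seq => z zF.
under eq_integral do rewrite -sumEFin.
rewrite (integral_sum measurableT)//; last by move=> w; exact: intg.
rewrite (bigD1_seq z)//= Ig eqxx mulr1 big1 ?adde0.
  by rewrite normc_sqr.
by move=> w wz; rewrite Ig eq_sym (negbTE wz) mulr0.
Qed.

(** * Bounds for the operator and its symbol *)

(** With [p] a partial sum at L^2 distance at most one from the transform [f],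
    [|f| <= |f - p| + |p| <= 1 + 2 |f - p|^2 + 2 |p|^2], whose integral is at
    most [1 + 2 + 2].  If no function qualifies as a transform, the chosen one
    is zero and the bound is trivial, so completeness of L^2 is avoided. *)
Lemma fourier_L1_majorant {R : realType} {n : nat} {hbar : R}
    {a : 'rV[int]_n -> R[i]} :
  hbar != 0 ->
  (forall F : {fset 'rV[int]_n}, \sum_(z <- F) normc (a z) ^+ 2 <= 1) ->
  exists h : n.-tuple (measurableTypeR R) -> \bar R,
    [/\ measurable_fun setT h,
       forall t, ((normc (fourier hbar a (torus_pt t)))%:E <= h t)%E
     & (\int[torus_measure n]_t h t <= 5%:E)%E].
Proof.
move=> h0 a1.
rewrite /fourier; case: xgetP => [f _ [mRe mIm cvgf]|_]; last first.
  exists (cst 0%E); split=> //.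
    by move=> t; rewrite ComplexField.Normc.normc0.
  by rewrite integral0 lee_fin.
have [F /= F1] : exists F : {fset 'rV[int]_n}, (\int[torus_measure n]_t
    (normc (f (torus_pt t) - fourier_psum hbar a F (torus_pt t)) ^+ 2)%:E <
    1%:E)%E.
  have : \forall F \near (@summability.totally 'rV[int]_n),
    (\int[torus_measure n]_t
    (normc (f (torus_pt t) - fourier_psum hbar a F (torus_pt t)) ^+ 2)%:E <
    1%:E)%E.
    apply: (cvgf [set y | (y < 1%:E)%E]).
    by apply: open_ereal_lt'; rewrite lte_fin.
  exact: (@filter_ex _ _ (@summability.totally_filter _)).
have [mp mp'] := measurable_fourier_psum hbar a F h0.
set p := fourier_psum hbar a F in F1 mp mp'.
pose q1 t := (normc (f (torus_pt t) - p (torus_pt t)) ^+ 2)%:E.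
pose q2 t := (normc (p (torus_pt t)) ^+ 2)%:E.
have fh t : ((normc (f (torus_pt t)))%:E <=
    1%:E + (2%:E * q1 t + 2%:E * q2 t))%E.
  rewrite -!EFinM -!EFinD lee_fin.
  have := le_normcD (f (torus_pt t) - p (torus_pt t)) (p (torus_pt t)).
  rewrite subrK => /le_trans; apply.
  set x := normc _; set y := normc _.
  (* 2 x^2 - x is minimal at x = 1/4, where it is -1/8 *)
  have := sqr_ge0 (x - 4^-1); have := sqr_ge0 (y - 4^-1); nra.
have mnormc (g : 'rV[R]_n -> R[i]) :
    measurable_fun setT (fun t : n.-tuple (measurableTypeR R) =>
      complex.Re (g (torus_pt t))) ->
    measurable_fun setT (fun t : n.-tuple (measurableTypeR R) =>
      complex.Im (g (torus_pt t))) ->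
    measurable_fun setT (fun t : n.-tuple (measurableTypeR R) =>
      (normc (g (torus_pt t)) ^+ 2)%:E).
  move=> mR mI; apply/measurable_EFinP.
  rewrite [X in measurable_fun _ X](_ : _ = fun t =>
    complex.Re (g (torus_pt t)) ^+ 2 + complex.Im (g (torus_pt t)) ^+ 2).
    by apply: measurable_funD; exact: measurable_funX.
  by apply/funext => t; rewrite normc_sqr; case: (g _) => x y /=; ring.
have mq1 : measurable_fun setT q1.
  apply: (mnormc (fun x => f x - p x)).
    rewrite [X in measurable_fun _ X](_ : _ = fun t =>
      complex.Re (f (torus_pt t)) - complex.Re (p (torus_pt t))).
      exact: measurable_funB.
    by apply/funext => t; rewrite raddfB.
  rewrite [X in measurable_fun _ X](_ : _ = fun t =>
    complex.Im (f (torus_pt t)) - complex.Im (p (torus_pt t))).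
    exact: measurable_funB.
  by apply/funext => t; rewrite raddfB.
have mq2 : measurable_fun setT q2 by exact: mnormc.
have q10 t : (0 <= q1 t)%E by rewrite lee_fin sqr_ge0.
have q20 t : (0 <= q2 t)%E by rewrite lee_fin sqr_ge0.
have q1' t : (0 <= 2%:E * q1 t)%E by apply: mule_ge0 => //; rewrite lee_fin.
have q2' t : (0 <= 2%:E * q2 t)%E by apply: mule_ge0 => //; rewrite lee_fin.
have Mq1 : measurable_fun setT (fun t => 2%:E * q1 t)%E.
  exact: measurable_funeM.
have Mq2 : measurable_fun setT (fun t => 2%:E * q2 t)%E.
  exact: measurable_funeM.
exists (fun t => 1%:E + (2%:E * q1 t + 2%:E * q2 t))%E; split => //.
  by apply: emeasurable_funD => //; exact: emeasurable_funD.
rewrite ge0_integralD//; last 2 first.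
- by move=> t _; apply: adde_ge0.
- exact: emeasurable_funD.
rewrite ge0_integralD// !ge0_integralZl// integral_cst//.
rewrite [X in (_ * X + _)%E](@probability_setT _ _ _ (torus_measure n)) mule1.
rewrite (_ : 5%:E = 1%:E + (2%:E * 1%:E + 2%:E * 1%:E))%E; last first.
  by rewrite -!EFinM -!EFinD; congr (_%:E); ring.
apply: leeD => //; apply: leeD; apply: lee_wpmul2l; rewrite ?lee_fin//.
- exact: ltW.
- by rewrite [leLHS]parseval_trig// lee_fin.
Qed.

Lemma normc_Tsigma_le {R : realType} {n : nat} {hbar : R}
    {sigma : 'rV[int]_n -> 'rV[R]_n -> R[i]} {a : 'rV[int]_n -> R[i]}
    {k : 'rV[int]_n} {M : R} :
  hbar != 0 ->
  (forall F : {fset 'rV[int]_n}, \sum_(z <- F) normc (a z) ^+ 2 <= 1) ->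
  (forall theta, normc (sigma k theta) <= M) ->
  normc (Tsigma hbar sigma a k) <= 10 * M.
Proof.
move=> h0 a1 sM.
have M0 : 0 <= M := le_trans (normc_ge0 _) (sM 0).
have [h [mh fh hle]] := fourier_L1_majorant h0 a1.
have hge t : (0 <= h t)%E by apply: le_trans (fh t); rewrite lee_fin normc_ge0.
rewrite (_ : 10 * M = 2 * (M * 5)); last by ring.
apply: (normc_torus_int_le (fun t => M%:E * h t)%E) => [t|].
  rewrite !ComplexField.Normc.normcM normc_character mul1r EFinM.
  by apply: lee_pmul; rewrite ?lee_fin ?normc_ge0.
rewrite ge0_integralZl// EFinM.
exact: lee_wpmul2l.
Qed.

Lemma mderiv0 {R : realType} {n : nat} (g : 'rV[R]_n -> R[i]) :
  mderiv [ffun=> 0%N] g = g.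
Proof. by rewrite /mderiv; elim: (enum _) => //= j s ->; rewrite ffunE. Qed.

Lemma symbol_sup_le {R : realType} {n : nat} {hbar mu delta : R} {N : nat}
    {sigma : 'rV[int]_n -> 'rV[R]_n -> R[i]} :
  symbol_estimate hbar mu delta N sigma ->
  exists C : R, forall k theta,
    normc (sigma k theta) <= C * (1 + enorm (latpt hbar k)) `^ mu.
Proof.
have o0 : mi_order ([ffun=> 0%N] : {ffun 'I_n -> nat}) = 0%N.
  by rewrite /mi_order big1// => j _; rewrite ffunE.
move=> [C HC]; exists (C [ffun=> 0%N]) => k theta.
have := HC [ffun=> 0%N]; rewrite o0 => /(_ (leq0n N) k theta).
by rewrite mderiv0 mulr0 addr0.
Qed.

Lemma powR_shift_le {R : realType} {mu nu x : R} :
  mu <= nu -> nu <= 0 -> 1 <= x -> (1 + x) `^ mu <= x `^ nu.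
Proof.
move=> munu nu0 x1; have x0 : 0 < x by exact: lt_le_trans x1.
apply: (@le_trans _ _ ((1 + x) `^ nu)); first by rewrite ler_powR// lerDl ltW.
rewrite /powR !gt_eqF ?addr_gt0// ler_expR ler_wnM2l// ler_ln ?posrE ?addr_gt0//.
by rewrite lerDr.
Qed.

(** * The eigenvalue asymptotics *)

Theorem lemma2 (R : realType) (n : nat) (hn : (0 < n)%N)
  (hbar : R) (hhbar : 0 < hbar) (mu delta : R)
  (hdelta : 0 <= delta) (hmu : mu < - ((n + 2)%:R * delta))
  (sigma : 'rV[int]_n -> 'rV[R]_n -> R[i])
  (sigma_periodic : forall k, torus_periodic (sigma k))
  (sigma_smooth : forall k, Cclass (n./2 + 1) (sigma k))
  (sigma_symbol : symbol_estimate hbar mu delta (n./2 + 1) sigma)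
  (T_l2 : forall a, l2 a -> l2 (Tsigma hbar sigma a))
  (phi : 'rV[int]_n -> 'rV[int]_n -> R[i])
  (lambda : 'rV[int]_n -> R[i])
  (phi_basis : orthonormal_basis phi)
  (phi_eigen : forall k m, Tsigma hbar sigma (phi k) m = lambda k * phi k m)
  (Delta_e : 'rV[int]_n -> 'rV[int]_n -> R[i])
  (phi_split : forall k m, phi k m = std_basis k m + Delta_e k m)
  (Delta_small : forall k, l2norm (Delta_e k) <= 1) :
  exists C K : R, forall k : 'rV[int]_n, K <= enorm (latpt hbar k) ->
    ComplexField.Normc.normc (lambda k - torus_int (sigma k)) <=
      C * enorm (latpt hbar k) `^ (mu + (n + 2)%:R * delta).
Proof.
have [C sigma_le] := symbol_sup_le sigma_symbol.
(* 22 = 20 + 2: the bounds for the eigenvalue and for the mean *)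
exists (22 * C), 1 => k k1; set nu := mu + _.
set M := C * (1 + enorm (latpt hbar k)) `^ mu.
have sM theta : normc (sigma k theta) <= M := sigma_le k theta.
have lambda_le : normc (lambda k) <= 20 * M.
  have := normc_Tsigma_le (lt0r_neq0 hhbar)
    (orthonormal_fsum_le1 phi_basis k) sM.
  rewrite phi_eigen ComplexField.Normc.normcM.
  have := diagonal_coeff_ge _ _ phi_basis (phi_split k) (Delta_small k).
  by have := normc_ge0 (lambda k); nra.
have int_le : normc (torus_int (sigma k)) <= 2 * M.
  apply: (normc_torus_int_le (cst M%:E)) => [t|].
    by rewrite lee_fin.
  by rewrite integral_cst//=
    [X in (_ * X)%E](@probability_setT _ _ _ (torus_measure n)) mule1.
have C0 : 0 <= C.
  have := le_trans (normc_ge0 _) (sM 0).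
  by rewrite pmulr_lge0// powR_gt0// ltr_pwDl ?sqrtr_ge0.
have nu0 : nu <= 0 by rewrite /nu -lerBrDr sub0r ltW.
have munu : mu <= nu by rewrite /nu lerDl mulr_ge0.
have := powR_shift_le munu nu0 k1.
move=> /(ler_wpM2l C0); rewrite -/M => M_le.
apply: le_trans (le_normcD _ _) _; rewrite normcN.
by lra.
Qed.
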